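(* Let $\gamma \geq 0$ and let $(u_0,u_1) \in \mathcal{K}$. Let $u$ be the maximal forward solution of the damped focusing Duffing equation $\ddot u + \gamma \dot u + u = u^3$, $(u(0),\dot u(0)) = (u_0,u_1)$, with maximal time of existence $T^+ \in (0,+\infty]$. (i) If $(u_0,u_1)\in\mathcal{K}^-$, then $u$ blows up in finite time, i.e. $T^+<+\infty$. In addition, if $\gamma>0$, then $E(u(t),\dot u(t)) \to -\infty$ as $t\to T^+$, $t<T^+$. (ii) If $(u_0,u_1)\in\mathcal{K}^+$, then $u$ is defined for all $t\geq 0$. In addition, if $\gamma>0$, then $(u(t),\dot u(t)) \to (0,0)$ as $t\to+\infty$, at an exponential rate.
   Context: All functions are real-valued. For $(u_0,u_1)\in\mathbb{R}^2$ set $E(u_0,u_1) = \frac{u_0^2}{2}-\frac{u_0^4}{4}+\frac{u_1^2}{2}$. Define $\mathcal{K} = \{(u_0,u_1)\in\mathbb{R}^2 : E(u_0,u_1)<\frac14\}$, $\mathcal{K}^+ = \{(u_0,u_1)\in\mathcal{K} : |u_0|<1\}$, $\mathcal{K}^- = \{(u_0,u_1)\in\mathcal{K} : |u_0|>1\}$ (so that $\mathcal{K}=\mathcal{K}^+\sqcup\mathcal{K}^-$). ''At an exponential rate'' means that there exist constants $C,c>0$ (possibly depending on the solution) such that the distance to the limit at time $t$ is at most $Ce^{-ct}$ for all $t\ge 0$. *)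

(* Defs.v *)
From Stdlib Require Import Reals.
From Coquelicot Require Import Coquelicot.
Open Scope R_scope.

Definition energy (p : R * R) : R :=
  fst p ^ 2 / 2 - fst p ^ 4 / 4 + snd p ^ 2 / 2.

Definition K (p : R * R) : Prop := energy p < 1 / 4.
Definition Kplus (p : R * R) : Prop := K p /\ Rabs (fst p) < 1.
Definition Kminus (p : R * R) : Prop := K p /\ Rabs (fst p) > 1.

(* The interval [0, T), with T possibly infinite. *)
Definition forward_interval (T : Rbar) (t : R) : Prop :=
  0 <= t /\ Rbar_lt t T.

(* Derivative relative to D: one-sided at an end point that belongs to D, so
   that the values of f outside D play no role. *)
Definition is_derive_in (D : R -> Prop) (f : R -> R) (t l : R) : Prop :=
  filterlim (fun s => (f s - f t) / (s - t))
    (within D (locally' t)) (locally l).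

(* u solves u'' + gamma u' + u = u^3 on [0, T) with initial data p, and du is
   its derivative there. *)
Definition is_forward_solution (gamma : R) (p : R * R) (T : Rbar)
    (u du : R -> R) : Prop :=
  Rbar_lt 0 T /\
  (u 0, du 0) = p /\
  forall t, forward_interval T t ->
    is_derive_in (forward_interval T) u t (du t) /\
    exists ddu : R,
      is_derive_in (forward_interval T) du t ddu /\
      ddu + gamma * du t + u t = u t ^ 3.

Definition is_maximal_forward_solution (gamma : R) (p : R * R) (T : Rbar)
    (u du : R -> R) : Prop :=
  is_forward_solution gamma p T u du /\
  forall (T' : Rbar) (w dw : R -> R),
    is_forward_solution gamma p T' w dw ->
    (forall t, forward_interval T t -> w t = u t) ->
    Rbar_le T' T.

Definition dist2 (p q : R * R) : R :=
  sqrt ((fst p - fst q) ^ 2 + (snd p - snd q) ^ 2).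

Definition tends_exponentially (f : R -> R * R) (l : R * R) : Prop :=
  filterlim f (Rbar_locally p_infty) (locally l) /\
  exists C c : R, 0 < C /\ 0 < c /\
    forall t, 0 <= t -> dist2 (f t) l <= C * exp (- c * t).

(* Main.v *)
(** A solution bounded up to a finite time can be continued: the Taylor
    coefficients at a point satisfy [|a_n| <= M rho^n] with [rho] depending only
    on a bound on the data, so the local time of existence is uniform. Since
    [E' = - gamma u'^2] and [E >= 1/4] where [|u| = 1], both regions are forward
    invariant.

    In K-, say [u > 1], the force [u^3 - u] is bounded below by a positive
    constant, so on a half-line [u] would become large and increasing; then
    [u' >= c u^2] persists and [1/u] reaches 0 in finite time. If moreover
    [gamma > 0] and [E] were bounded below, [u'^2] would be integrable up to [T],
    hence [u] bounded, contradicting maximality.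

    In K+, [|u| < 1] and the energy bound [u'], so the solution is global, and
    [E + eps u u'] is a strict Lyapunov function comparable to [u^2 + u'^2]. *)

Require Import Defs.
From Stdlib Require Import Reals Lra Lia Ranalysis5 Classical.
From Coquelicot Require Import Coquelicot.
Open Scope R_scope.

(** * Calculus *)

(* [auto_derive], with the derivatives of unknown functions read off the
   hypotheses. *)
Ltac derive_from_hyps :=
  auto_derive;
  [ repeat split; trivial; eexists; eassumption
  | repeat match goal with
    | H : is_derive ?f ?t ?l |- context [Derive ?g ?s] =>
        replace (Derive g s) with l
          by (symmetry; exact (is_derive_unique f t l H))
    end ].

Lemma is_derive_continuity_pt (f : R -> R) (x l : R) :
  is_derive f x l -> continuity_pt f x.
Proof.
  intros H. apply derivable_continuous_pt. exists l.
  now apply is_derive_Reals.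
Qed.

Lemma derive_nonneg_le (f f' : R -> R) (a b : R) :
  a <= b ->
  (forall t, a <= t <= b -> is_derive f t (f' t)) ->
  (forall t, a <= t <= b -> 0 <= f' t) ->
  f a <= f b.
Proof.
  intros [Hab | <-] Hd Hp; [|lra].
  destruct (MVT_cor2 f f' a b Hab) as (c & Hc & Hc').
  - intros c Hc. now apply is_derive_Reals, Hd.
  - assert (0 <= f' c) by (apply Hp; lra). nra.
Qed.

Lemma derive_nonpos_ge (f f' : R -> R) (a b : R) :
  a <= b ->
  (forall t, a <= t <= b -> is_derive f t (f' t)) ->
  (forall t, a <= t <= b -> f' t <= 0) ->
  f b <= f a.
Proof.
  intros Hab Hd Hp.
  enough (- f a <= - f b) by lra.
  apply (derive_nonneg_le (fun t => - f t) (fun t => - f' t)); trivial.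
  - intros t Ht. apply (is_derive_opp f). now apply Hd.
  - intros t Ht. specialize (Hp t Ht). lra.
Qed.

Lemma derive_ge_linear (f f' : R -> R) (m a b : R) :
  a <= b ->
  (forall t, a <= t <= b -> is_derive f t (f' t)) ->
  (forall t, a <= t <= b -> m <= f' t) ->
  f a + m * (b - a) <= f b.
Proof.
  intros Hab Hd Hm.
  enough (f a - m * a <= f b - m * b) by lra.
  apply (derive_nonneg_le (fun t => f t - m * t) (fun t => f' t - m)); trivial.
  - intros t Ht. specialize (Hd t Ht). derive_from_hyps. ring.
  - intros t Ht. specialize (Hm t Ht). lra.
Qed.

(** The weight [exp (- k * t)] turns the inequality into monotonicity. Both signs of [k] occur: a
    positive rate bounds the gap between two solutions, a negative one gives the decay. *)
Lemma gronwall_le (f f' : R -> R) (k a b : R) :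
  a <= b ->
  (forall t, a <= t <= b -> is_derive f t (f' t)) ->
  (forall t, a <= t <= b -> f' t <= k * f t) ->
  f b <= f a * exp (k * (b - a)).
Proof.
  intros Hab Hd Hk.
  assert (H : f b * exp (- k * b) <= f a * exp (- k * a)).
  { apply (derive_nonpos_ge (fun t => f t * exp (- k * t))
      (fun t => (f' t - k * f t) * exp (- k * t))); trivial.
    - intros t Ht. specialize (Hd t Ht). derive_from_hyps. ring.
    - intros t Ht. specialize (Hk t Ht).
      pose proof (exp_pos (- k * t)). nra. }
  replace (k * (b - a)) with (- k * a + k * b) by ring.
  replace (f b) with (f b * exp (- k * b) * exp (k * b)).
  - rewrite exp_plus, <- Rmult_assoc.
    apply Rmult_le_compat_r; trivial. apply Rlt_le, exp_pos.
  - rewrite Rmult_assoc, <- exp_plus.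
    replace (- k * b + k * b) with 0 by ring. rewrite exp_0. ring.
Qed.

(* Beyond the last point where f is nonnegative, f would be nondecreasing. *)
Lemma barrier_nonneg (f f' : R -> R) (a b : R) :
  a <= b ->
  (forall t, a <= t <= b -> is_derive f t (f' t)) ->
  (forall t, a <= t <= b -> f t < 0 -> 0 <= f' t) ->
  0 <= f a -> 0 <= f b.
Proof.
  intros Hab Hd Hbar Ha.
  destruct (Rle_or_lt 0 (f b)) as [|Hb]; trivial. exfalso.
  set (S := fun t => a <= t <= b /\ 0 <= f t).
  destruct (completeness S) as [c [Hub Hleast]].
  { exists b. intros t [Ht _]. lra. }
  { exists a. split; lra. }
  assert (Hac : a <= c) by (apply Hub; split; lra).
  assert (Hcb : c <= b) by (apply Hleast; intros t [Ht _]; lra).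
  assert (Hfc : 0 <= f c).
  { destruct (Rle_or_lt 0 (f c)) as [|Hc]; trivial. exfalso.
    assert (Hcont : continuity_pt f c)
      by (apply (is_derive_continuity_pt f c (f' c)), Hd; lra).
    destruct (Hcont (- f c)) as (e & He & Hcl); [lra|].
    (* By continuity [f] is negative on a left neighbourhood of [c], so a smaller number would still
       bound [S]. *)
    assert (c <= c - e / 2); [|lra].
    apply Hleast. intros t [Ht Hft].
    destruct (Rle_or_lt t (c - e / 2)) as [|Hlt]; trivial. exfalso.
    assert (t <= c) by (apply Hub; now split).
    destruct (Req_dec t c) as [->|Htc]; [lra|].
    assert (Hdist : Rabs (f t - f c) < - f c).
    { apply Hcl. split; [split; [exact I|auto]|].
      simpl; unfold Rdist. apply Rabs_def1; lra. }
    apply Rabs_def2 in Hdist. lra. }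
  destruct Hcb as [Hcb | ->]; [|lra].
  destruct (MVT_cor2 f f' c b Hcb) as (x & Hx & Hx').
  - intros x Hx. apply is_derive_Reals, Hd. lra.
  - assert (f x < 0).
    { destruct (Rle_or_lt 0 (f x)) as [Hn|]; trivial.
      assert (x <= c) by (apply Hub; split; lra). lra. }
    assert (0 <= f' x) by (apply Hbar; lra). nra.
Qed.

(** * Solutions of the equation *)

(** The working form of the equation: two-sided derivatives, solved for the second one. [D] will be
    a half-open interval, a compact interval or a ball. *)
Definition duffing_on (gamma : R) (D : R -> Prop) (u du : R -> R) : Prop :=
  forall t, D t ->
    is_derive u t (du t) /\ is_derive du t (u t ^ 3 - u t - gamma * du t).

(** * Local existence by power series, and uniqueness *)

Lemma course_of_values (F : nat -> (nat -> R) -> R) :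
  (forall n a b, (forall k, (k < n)%nat -> a k = b k) -> F n a = F n b) ->
  exists a, forall n, a n = F n a.
Proof.
  intros HF.
  (* [g n] holds the final values below [n]; what it holds from [n] on is filler, which [F n]
     ignores by [HF]. *)
  set (g := fix g n := match n with
    | O => fun _ => 0
    | S m => fun k => if Nat.ltb k m then g m k else F m (g m)
    end).
  assert (Hdiag : forall n, g (S n) n = F n (g n)).
  { intros n. simpl. now rewrite Nat.ltb_irrefl. }
  assert (Hst : forall n k, (k < n)%nat -> g n k = g (S k) k).
  { induction n as [|n IH]; intros k Hk; [lia|].
    destruct (Nat.eq_dec k n) as [->|Hne]; trivial.
    transitivity (g n k); [|apply IH; lia].
    simpl. destruct (Nat.ltb_spec k n); [reflexivity|lia]. }
  exists (fun n => g (S n) n). intros n. rewrite Hdiag.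
  apply HF. intros k Hk. now apply Hst.
Qed.

(** The Cauchy product has [n + 1] terms, each bounded by [A * B * (n + 1) ^ p * rho ^ n]. The
    exponent [p] keeps track of the factors gained when products are iterated. *)
Lemma PS_mult_bound (a b : nat -> R) (A B rho : R) (p : nat) (n : nat) :
  0 <= rho ->
  (forall k, (k <= n)%nat -> Rabs (a k) <= A * INR (S k) ^ p * rho ^ k) ->
  (forall k, (k <= n)%nat -> Rabs (b k) <= B * rho ^ k) ->
  Rabs (PS_mult a b n) <= A * B * INR (S n) ^ S p * rho ^ n.
Proof.
  intros Hrho Ha Hb. unfold PS_mult.
  eapply Rle_trans; [apply Rsum_abs|].
  eapply Rle_trans.
  - apply sum_Rle with (Bn := fun _ => A * B * INR (S n) ^ p * rho ^ n).
    intros k Hk. rewrite Rabs_mult.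
    assert (HB : 0 <= B).
    { specialize (Hb 0%nat (Nat.le_0_l n)). simpl in Hb.
      pose proof (Rabs_pos (b 0%nat)). lra. }
    assert (HA : 0 <= A).
    { specialize (Ha 0%nat (Nat.le_0_l n)). simpl in Ha.
      rewrite pow1 in Ha. pose proof (Rabs_pos (a 0%nat)). lra. }
    eapply Rle_trans.
    + apply Rmult_le_compat; try apply Rabs_pos; [now apply Ha|].
      apply Hb. lia.
    + replace (rho ^ n) with (rho ^ k * rho ^ (n - k))
        by (rewrite <- pow_add; f_equal; lia).
      assert (Hp : INR (S k) ^ p <= INR (S n) ^ p).
      { apply pow_incr. split; [apply pos_INR|]. apply le_INR; lia. }
      assert (0 <= rho ^ k * rho ^ (n - k))
        by (apply Rmult_le_pos; now apply pow_le).
      assert (0 <= A * B) by nra.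
      replace (A * INR (S k) ^ p * rho ^ k * (B * rho ^ (n - k)))
        with (A * B * INR (S k) ^ p * (rho ^ k * rho ^ (n - k))) by ring.
      apply Rmult_le_compat_r; trivial.
      now apply Rmult_le_compat_l.
  - rewrite sum_cte. simpl. apply Req_le. ring.
Qed.

Lemma INR_S_le_pow2 (n : nat) : INR (S n) <= 2 ^ n.
Proof.
  induction n as [|n IH]; [simpl; lra|].
  rewrite S_INR. simpl pow.
  pose proof (pow_R1_Rle 2 n). lra.
Qed.

Lemma CV_radius_geometric (a : nat -> R) (A rho : R) :
  0 < rho -> (forall n, Rabs (a n) <= A * rho ^ n) ->
  Rbar_le (/ rho) (CV_radius a).
Proof.
  intros Hrho Ha. apply (proj1 (CV_radius_bounded a)).
  exists A. intros n. rewrite Rabs_mult, (Rabs_pos_eq ((/ rho) ^ n)).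
  - specialize (Ha n).
    assert (0 < rho ^ n) by now apply pow_lt.
    rewrite pow_inv.
    apply Rmult_le_reg_r with (rho ^ n); trivial.
    rewrite Rmult_assoc, Rinv_l by lra. lra.
  - apply pow_le, Rlt_le, Rinv_0_lt_compat; trivial.
Qed.

(** The recurrence comes from inserting a power series into the equation. In the induction the two
    Cauchy products of the cube cost a factor [(n + 1) ^ 2], which the denominator
    [(n + 1) * (n + 2)] absorbs. *)
Lemma duffing_coefficients (gamma M p q : R) :
  0 <= gamma -> 1 <= M -> Rabs p <= M -> Rabs q <= M ->
  exists a : nat -> R,
    a 0%nat = p /\ a 1%nat = q /\
    (forall n, PS_derive (PS_derive a) n =
       PS_mult (PS_mult a a) a n - a n - gamma * PS_derive a n) /\
    forall n, Rabs (a n) <= M * (gamma + 1 + M ^ 2) ^ n.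
Proof.
  intros Hg HM Hp Hq.
  destruct (course_of_values (fun n a => match n with
    | 0%nat => p
    | 1%nat => q
    | S (S m) => (PS_mult (PS_mult a a) a m - a m - gamma * PS_derive a m)
                 / (INR (S m) * INR (S (S m)))
    end)) as [a Ha].
  { intros [|[|m]] a b Hab; trivial.
    unfold PS_derive, PS_mult.
    rewrite (Hab m), (Hab (S m)) by lia.
    do 3 f_equal. apply sum_eq. intros i Hi.
    rewrite (Hab (m - i)%nat) by lia. f_equal.
    apply sum_eq. intros j Hj. now rewrite (Hab j), (Hab (i - j)%nat) by lia. }
  exists a. split; [exact (Ha 0%nat)|]. split; [exact (Ha 1%nat)|].
  assert (Hrec : forall n, a (S (S n)) =
    (PS_mult (PS_mult a a) a n - a n - gamma * PS_derive a n)
      / (INR (S n) * INR (S (S n)))) by (intros n; exact (Ha (S (S n)))).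
  split.
  { intros n. unfold PS_derive at 1 2. rewrite (Hrec n). field.
    split; apply not_0_INR; lia. }
  set (rho := gamma + 1 + M ^ 2).
  (* This closes the induction: the summands stem from the damping, the linear term and the cube,
     and [rho ^ 2] from the shift by two indices. *)
  assert (Hrho : gamma * rho + 1 + M ^ 2 <= rho ^ 2) by (unfold rho; nra).
  assert (Hrho1 : 1 <= rho) by (unfold rho; nra).
  induction n as [n IH] using (well_founded_induction Wf_nat.lt_wf).
  destruct n as [|[|n]].
  - rewrite (Ha 0%nat). simpl. lra.
  - rewrite (Ha 1%nat). simpl. nra.
  - rewrite Hrec.
    set (s := INR (S n)).
    assert (Hs : 1 <= s) by (unfold s; rewrite S_INR; pose proof (pos_INR n); lra).
    replace (INR (S (S n))) with (s + 1) by (unfold s; now rewrite <- S_INR).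
    assert (Hc : Rabs (PS_mult (PS_mult a a) a n) <= M * M * M * s ^ 2 * rho ^ n).
    { apply PS_mult_bound; [lra| |intros k Hk; apply IH; lia].
      intros k Hk. apply PS_mult_bound; [lra| |intros j Hj; apply IH; lia].
      intros j Hj. simpl. rewrite Rmult_1_r. apply IH. lia. }
    assert (H0 : Rabs (a n) <= M * rho ^ n) by (apply IH; lia).
    assert (H1 : Rabs (PS_derive a n) <= s * (M * (rho * rho ^ n))).
    { unfold PS_derive. rewrite Rabs_mult, (Rabs_pos_eq (INR (S n))) by apply pos_INR.
      apply Rmult_le_compat_l; [apply pos_INR|]. apply (IH (S n)). lia. }
    unfold Rdiv. rewrite Rabs_mult, Rabs_inv, (Rabs_pos_eq (s * (s + 1))) by nra.
    apply Rmult_le_reg_r with (s * (s + 1)); [nra|].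
    rewrite Rmult_assoc, Rinv_l by nra. rewrite Rmult_1_r.
    assert (Hr : 0 < rho ^ n) by (apply pow_lt; lra).
    set (r := rho ^ n) in *.
    replace (rho ^ S (S n)) with (rho ^ 2 * r) by (unfold r; simpl; ring).
    apply Rle_trans with (M * M * M * s ^ 2 * r + M * r
                            + gamma * (s * (M * (rho * r)))).
    + eapply Rle_trans; [apply Rabs_triang|]. rewrite Rabs_Ropp, Rabs_mult, (Rabs_pos_eq gamma) by lra.
      apply Rplus_le_compat; [|now apply Rmult_le_compat_l].
      eapply Rle_trans; [apply Rabs_triang|]. rewrite Rabs_Ropp.
      now apply Rplus_le_compat.
    + apply Rle_trans with (M * r * (s * (s + 1)) * (gamma * rho + 1 + M ^ 2)).
      * assert (HMr : 0 <= M * r) by nra.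
        assert (M ^ 2 * s ^ 2 + 1 + gamma * s * rho
                <= s * (s + 1) * (gamma * rho + 1 + M ^ 2)).
        { assert (0 <= gamma * rho) by nra.
          assert (s <= s * (s + 1)) by nra.
          assert (1 <= s * (s + 1)) by nra.
          assert (s ^ 2 <= s * (s + 1)) by nra.
          assert (0 <= M ^ 2) by nra.
          assert (M ^ 2 * s ^ 2 <= M ^ 2 * (s * (s + 1))) by nra.
          assert (gamma * rho * s <= gamma * rho * (s * (s + 1))) by nra.
          nra. }
        nra.
      * assert (0 <= M * r * (s * (s + 1))) by (apply Rmult_le_pos; nra).
        nra.
Qed.

(* The time of existence only depends on a bound on the data; the solution is
   the sum of its Taylor series. *)
Lemma local_existence (gamma M : R) :
  0 <= gamma -> 1 <= M ->
  exists r, 0 < r /\ forall p q, Rabs p <= M -> Rabs q <= M ->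
    exists y dy, y 0 = p /\ dy 0 = q /\
      duffing_on gamma (fun t => Rabs t < r) y dy.
Proof.
  intros Hg HM.
  set (rho := gamma + 1 + M ^ 2).
  assert (Hrho : 1 <= rho) by (unfold rho; nra).
  (* The series of [a * a] must converge as well: its coefficients carry a factor [n + 1 <= 2 ^ n],
     paid for by doubling [rho]. *)
  exists (/ (2 * rho)). split; [apply Rinv_0_lt_compat; lra|].
  intros p q Hp Hq.
  destruct (duffing_coefficients gamma M p q) as (a & Ha0 & Ha1 & Hrec & Hb);
    trivial.
  fold rho in Hb.
  exists (PSeries a), (PSeries (PS_derive a)).
  split; [now rewrite PSeries_0|].
  split; [rewrite PSeries_0; unfold PS_derive; rewrite Ha1; simpl; ring|].
  intros t Ht.
  assert (Hra : Rbar_lt (Rabs t) (CV_radius a)).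
  { apply Rbar_lt_le_trans with (/ (2 * rho)); [exact Ht|].
    apply CV_radius_geometric with M; [lra|]. intros n.
    eapply Rle_trans; [apply Hb|]. apply Rmult_le_compat_l; [lra|].
    apply pow_incr. lra. }
  assert (Hra2 : Rbar_lt (Rabs t) (CV_radius (PS_mult a a))).
  { apply Rbar_lt_le_trans with (/ (2 * rho)); [exact Ht|].
    apply CV_radius_geometric with (M * M); [lra|]. intros n.
    eapply Rle_trans.
    - apply PS_mult_bound with (p := 0%nat) (A := M) (B := M) (rho := rho);
        [lra| |intros k _; apply Hb].
      intros k _. simpl. rewrite Rmult_1_r. apply Hb.
    - rewrite Rpow_mult_distr, pow_1, (Rmult_assoc (M * M)).
      apply Rmult_le_compat_l; [nra|].
      apply Rmult_le_compat_r; [apply pow_le; lra|]. apply INR_S_le_pow2. }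
  split; [now apply is_derive_PSeries|].
  replace (PSeries a t ^ 3 - PSeries a t - gamma * PSeries (PS_derive a) t)
    with (PSeries (PS_derive (PS_derive a)) t).
  { apply is_derive_PSeries. now rewrite CV_radius_derive. }
  rewrite (PSeries_ext _ (PS_minus (PS_minus (PS_mult (PS_mult a a) a) a)
    (PS_scal gamma (PS_derive a)))) by (intros n; rewrite Hrec; reflexivity).
  rewrite !PSeries_minus, PSeries_scal, !PSeries_mult; trivial.
  - ring.
  - now apply ex_pseries_mult.
  - now apply CV_radius_inside.
  - apply ex_pseries_minus; [now apply ex_pseries_mult|now apply CV_radius_inside].
  - apply ex_pseries_scal; [apply Rmult_comm|].
    apply CV_radius_inside. now rewrite CV_radius_derive.
Qed.

(** Gronwall for the squared distance [Z] in the phase plane. Since [u^3 - y^3 = (u - y) * Q], the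
    maximum of [Q] on the compact interval serves as the rate; the linear terms cancel in [Z'] and
    the damping only helps. *)
Lemma duffing_unique (gamma a b : R) (u du y dy : R -> R) :
  0 <= gamma -> a <= b ->
  duffing_on gamma (fun t => a <= t <= b) u du ->
  duffing_on gamma (fun t => a <= t <= b) y dy ->
  u a = y a -> du a = dy a ->
  u b = y b /\ du b = dy b.
Proof.
  intros Hg Hab Hu Hy H0 H1.
  set (Q := fun t => u t ^ 2 + u t * y t + y t ^ 2).
  destruct (continuity_ab_maj Q a b Hab) as (m & Hm & _).
  { intros c Hc. destruct (Hu c Hc) as [Hu' _]. destruct (Hy c Hc) as [Hy' _].
    apply is_derive_continuity_pt with
      (2 * u c * du c + (du c * y c + u c * dy c) + 2 * y c * dy c).
    unfold Q. derive_from_hyps. ring. }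
  set (Z := fun t => (u t - y t) ^ 2 + (du t - dy t) ^ 2).
  assert (HZ : Z b <= Z a * exp (Q m * (b - a))).
  { apply gronwall_le with (f' := fun t =>
      2 * (u t - y t) * (du t - dy t) * Q t - 2 * gamma * (du t - dy t) ^ 2);
      trivial.
    - intros c Hc. destruct (Hu c Hc) as [Hu' Hu2].
      destruct (Hy c Hc) as [Hy' Hy2].
      unfold Z. derive_from_hyps.
      unfold Q. ring.
    - intros c Hc. specialize (Hm c Hc).
      assert (HQ : 0 <= Q c).
      { unfold Q. pose proof (pow2_ge_0 (u c + y c / 2)).
        pose proof (pow2_ge_0 (y c)). lra. }
      unfold Z. generalize (u c - y c) (du c - dy c). intros d e.
      pose proof (pow2_ge_0 (d - e)).
      pose proof (pow2_ge_0 d). pose proof (pow2_ge_0 e).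
      assert (0 <= gamma * e ^ 2) by nra.
      assert (2 * d * e * Q c <= (d ^ 2 + e ^ 2) * Q c) by nra.
      nra. }
  replace (Z a) with 0 in HZ by (unfold Z; rewrite H0, H1; ring).
  rewrite Rmult_0_l in HZ. unfold Z in HZ.
  pose proof (pow2_ge_0 (u b - y b)). pose proof (pow2_ge_0 (du b - dy b)).
  split; apply Rminus_diag_uniq, Rsqr_0_uniq; unfold Rsqr; lra.
Qed.

(** * From one-sided to two-sided derivatives *)

Lemma is_derive_in_iff (D : R -> Prop) (f : R -> R) (t l : R) :
  is_derive_in D f t l <->
  forall eps, 0 < eps -> exists d, 0 < d /\
    forall s, Rabs (s - t) < d -> s <> t -> D s ->
      Rabs ((f s - f t) / (s - t) - l) < eps.
Proof.
  unfold is_derive_in. rewrite filterlim_locally. split.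
  - intros H eps Heps. destruct (H (mkposreal eps Heps)) as [d Hd].
    exists d. split; [apply cond_pos|]. intros s Hs Hne HD.
    exact (Hd s Hs Hne HD).
  - intros H eps. destruct (H eps (cond_pos eps)) as (d & Hd & Hs).
    exists (mkposreal d Hd). intros s Hs1 Hne HD. exact (Hs s Hs1 Hne HD).
Qed.

Lemma is_derive_iff (f : R -> R) (t l : R) :
  is_derive f t l <->
  forall eps, 0 < eps -> exists d, 0 < d /\
    forall s, Rabs (s - t) < d -> s <> t ->
      Rabs ((f s - f t) / (s - t) - l) < eps.
Proof.
  rewrite is_derive_Reals. split.
  - intros H eps Heps. destruct (H eps Heps) as [d Hd].
    exists d. split; [apply cond_pos|]. intros s Hs Hne.
    specialize (Hd (s - t)). replace (t + (s - t)) with s in Hd by ring.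
    apply Hd; trivial. lra.
  - intros H eps Heps. destruct (H eps Heps) as (d & Hd & Hs).
    exists (mkposreal d Hd). intros h Hh0 Hh.
    specialize (Hs (t + h)). replace (t + h - t) with h in Hs by ring.
    apply Hs; trivial. lra.
Qed.

Lemma is_derive_is_derive_in (D : R -> Prop) (f : R -> R) (t l : R) :
  is_derive f t l -> is_derive_in D f t l.
Proof.
  rewrite is_derive_iff, is_derive_in_iff. intros H eps Heps.
  destruct (H eps Heps) as (d & Hd & Hs). exists d. auto.
Qed.

(* Continued affinely to negative times, a forward solution has two-sided
   derivatives on the whole of [0, T). *)
Definition extend_left (f : R -> R) (l t : R) : R :=
  if Rlt_dec t 0 then f 0 + l * t else f t.

Lemma extend_left_eq (f : R -> R) (l t : R) :
  0 <= t -> extend_left f l t = f t.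
Proof. intros Ht. unfold extend_left. destruct (Rlt_dec t 0); lra. Qed.

Lemma is_derive_extend_left (T : Rbar) (f : R -> R) (l t l0 : R) :
  forward_interval T t -> (t = 0 -> l0 = l) ->
  is_derive_in (forward_interval T) f t l -> is_derive (extend_left f l0) t l.
Proof.
  intros [Ht HtT] Hl0. rewrite is_derive_in_iff, is_derive_iff.
  intros H eps Heps. destruct (H eps Heps) as (d & Hd & Hs).
  assert (HT : exists e, 0 < e /\ forall s, Rabs (s - t) < e -> Rbar_lt s T).
  { destruct T as [T0| |]; simpl in *; [|now exists 1; split; [lra|]|easy].
    exists (T0 - t). split; [lra|]. intros s Hst.
    apply Rabs_def2 in Hst. lra. }
  destruct HT as (e & He & HeT).
  destruct Ht as [Ht | <-].
  - exists (Rmin (Rmin d e) t). split; [repeat apply Rmin_glb_lt; lra|].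
    intros s Hst Hne.
    assert (Rabs (s - t) < d /\ Rabs (s - t) < e /\ Rabs (s - t) < t) as (H1 & H2 & H3).
    { pose proof (Rmin_l (Rmin d e) t). pose proof (Rmin_r (Rmin d e) t).
      pose proof (Rmin_l d e). pose proof (Rmin_r d e). lra. }
    apply Rabs_def2 in H3. rewrite !extend_left_eq by lra.
    apply Hs; trivial. split; [lra|]. now apply HeT.
  - exists (Rmin d e). split; [now apply Rmin_glb_lt|].
    intros s Hst Hne.
    assert (Rabs (s - 0) < d /\ Rabs (s - 0) < e) as (H1 & H2).
    { pose proof (Rmin_l d e). pose proof (Rmin_r d e). lra. }
    rewrite (extend_left_eq _ _ 0) by lra.
    (* To the left of 0 the difference quotient is exactly the slope; to the right it is that of
       [f]. *)
    unfold extend_left. destruct (Rlt_dec s 0) as [Hneg | Hpos].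
    + rewrite Hl0 by trivial.
      replace ((f 0 + l * s - f 0) / (s - 0) - l) with 0 by (field; lra).
      now rewrite Rabs_R0.
    + apply Hs; trivial. split; [lra|]. now apply HeT.
Qed.

Lemma duffing_of_forward (gamma : R) (p : R * R) (T : Rbar) (u du : R -> R) :
  is_forward_solution gamma p T u du ->
  exists v dv, (forall t, 0 <= t -> v t = u t /\ dv t = du t) /\
    duffing_on gamma (forward_interval T) v dv.
Proof.
  intros (HT & Hp & Hsol).
  (* The slopes are the derivatives that the solution has at 0, the second one read off the
     equation. *)
  exists (extend_left u (du 0)),
    (extend_left du (u 0 ^ 3 - u 0 - gamma * du 0)).
  split; [intros t Ht; now rewrite !extend_left_eq|].
  intros t Ht. destruct (Hsol t Ht) as (H1 & ddu & H2 & Heq).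
  assert (0 <= t) by apply Ht.
  rewrite !extend_left_eq by trivial. split.
  - apply is_derive_extend_left with T; trivial. now intros ->.
  - replace (u t ^ 3 - u t - gamma * du t) with ddu by lra.
    apply is_derive_extend_left with T; trivial. intros ->. lra.
Qed.

Lemma forward_of_duffing (gamma : R) (p : R * R) (T : Rbar) (u du : R -> R) :
  Rbar_lt 0 T -> (u 0, du 0) = p ->
  duffing_on gamma (forward_interval T) u du ->
  is_forward_solution gamma p T u du.
Proof.
  intros HT Hp Hsol. split; [|split]; trivial.
  intros t Ht. destruct (Hsol t Ht) as [H1 H2].
  split; [now apply is_derive_is_derive_in|].
  eexists. split; [apply is_derive_is_derive_in, H2|ring].
Qed.

(** * Continuation past a finite time *)

Lemma duffing_shift (gamma r c : R) (u du : R -> R) :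
  duffing_on gamma (fun t => Rabs t < r) u du ->
  duffing_on gamma (fun t => Rabs (t - c) < r)
    (fun t => u (t - c)) (fun t => du (t - c)).
Proof.
  intros H t Ht. destruct (H _ Ht) as [H1 H2].
  split; derive_from_hyps; ring.
Qed.

(** The data bound gives a lifetime [r] that is the same at every restart. Restarting within [r / 2]
    of [T] therefore leads past [T], and uniqueness makes the two pieces agree on their overlap. *)
Lemma duffing_extend (gamma T M : R) (u du : R -> R) :
  0 <= gamma -> 0 < T ->
  duffing_on gamma (forward_interval T) u du ->
  (forall t, forward_interval T t -> Rabs (u t) <= M /\ Rabs (du t) <= M) ->
  exists T' w dw, T < T' /\
    (forall t, t < T -> w t = u t /\ dw t = du t) /\
    duffing_on gamma (forward_interval T') w dw.
Proof.
  intros Hg HT Hsol HM.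
  destruct (local_existence gamma (Rmax 1 M) Hg (Rmax_l _ _)) as (r & Hr & Hloc).
  set (c := Rmax 0 (T - r / 2)).
  assert (Hc : 0 <= c /\ T - r / 2 <= c /\ c < T).
  { split; [apply Rmax_l|]. split; [apply Rmax_r|]. apply Rmax_lub_lt; lra. }
  destruct Hc as (Hc0 & HcT & HcT').
  destruct (HM c) as [Hb1 Hb2]; [split; simpl; lra|].
  destruct (Hloc (u c) (du c)) as (y & dy & Hy0 & Hdy0 & Hy).
  { eapply Rle_trans; [exact Hb1|apply Rmax_r]. }
  { eapply Rle_trans; [exact Hb2|apply Rmax_r]. }
  apply (duffing_shift _ _ c) in Hy.
  set (w := fun t => if Rlt_dec t T then u t else y (t - c)).
  set (dw := fun t => if Rlt_dec t T then du t else dy (t - c)).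
  assert (Hagree : forall t, c <= t < T -> u t = y (t - c) /\ du t = dy (t - c)).
  { intros t Ht.
    apply (duffing_unique gamma c t u du
             (fun t => y (t - c)) (fun t => dy (t - c))); trivial; try lra.
    - intros s Hs. apply Hsol. split; simpl; lra.
    - intros s Hs. apply Hy. rewrite Rabs_pos_eq; lra.
    - now rewrite Rminus_diag.
    - now rewrite Rminus_diag. }
  exists (c + r), w, dw. split; [lra|]. split.
  { intros t Ht. unfold w, dw. destruct (Rlt_dec t T); [easy|lra]. }
  intros t [Ht0 Ht]. simpl in Ht.
  destruct (Rlt_or_le t T) as [HtT | HtT].
  - assert (Hnear : locally t (fun s => s < T)) by now apply (open_lt T).
    assert (Hs : forward_interval T t) by (split; trivial).
    destruct (Hsol t Hs) as [H1 H2].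
    replace (w t) with (u t) by (unfold w; destruct (Rlt_dec t T); [easy|lra]).
    replace (dw t) with (du t) by (unfold dw; destruct (Rlt_dec t T); [easy|lra]).
    split; (eapply is_derive_ext_loc; [|eassumption]);
      (eapply filter_imp; [|exact Hnear]); intros s Hst;
      unfold w, dw; destruct (Rlt_dec s T); (reflexivity || lra).
  (* At [t = T] every neighbourhood contains times where [w] is still [u]; there [Hagree] identifies
     it with the restarted solution. *)
  - assert (Hnear : locally t (fun s => c < s)) by (apply (open_gt c); lra).
    destruct (Hy t) as [H1 H2]; [rewrite Rabs_pos_eq; lra|].
    replace (w t) with (y (t - c)) by (unfold w; destruct (Rlt_dec t T); [lra|easy]).
    replace (dw t) with (dy (t - c)) by (unfold dw; destruct (Rlt_dec t T); [lra|easy]).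
    split; (eapply is_derive_ext_loc; [|eassumption]);
      (eapply filter_imp; [|exact Hnear]); intros s Hst;
      unfold w, dw; simpl; destruct (Rlt_dec s T); trivial;
      symmetry; apply Hagree; lra.
Qed.

(** Here [T] is a real number: a bounded solution would continue past this finite time, against
    maximality. *)
Lemma maximal_not_bounded (gamma T M : R) (p : R * R) (u du : R -> R) :
  0 <= gamma ->
  is_maximal_forward_solution gamma p T u du ->
  ~ (forall t, forward_interval T t -> Rabs (u t) <= M /\ Rabs (du t) <= M).
Proof.
  intros Hg [Hsol Hmax] HM.
  destruct (duffing_of_forward _ _ _ _ _ Hsol) as (v & dv & Hv & Hdv).
  destruct Hsol as (HT & Hp & _). simpl in HT.
  destruct (duffing_extend gamma T M v dv) as (T' & w & dw & HT' & Hw & Hdw);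
    trivial.
  { intros t Ht. destruct (Hv t (proj1 Ht)) as [-> ->]. now apply HM. }
  assert (Hle : Rbar_le T' T); [|simpl in Hle; lra].
  apply (Hmax T' w dw).
  - apply forward_of_duffing; trivial; [simpl; lra|].
    destruct (Hw 0 HT) as [-> ->]. destruct (Hv 0) as [-> ->]; [lra|]. trivial.
  - intros t [Ht HtT]. simpl in HtT.
    destruct (Hw t HtT) as [-> _]. now apply Hv.
Qed.

(** * Energy and the invariant regions *)

Lemma forward_interval_le (T : Rbar) (s t : R) :
  0 <= s <= t -> forward_interval T t -> forward_interval T s.
Proof.
  intros Hs [_ Ht]. split; [lra|].
  apply Rbar_le_lt_trans with t; trivial. simpl. lra.
Qed.

Lemma is_derive_energy (gamma : R) (D : R -> Prop) (u du : R -> R) (t : R) :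
  duffing_on gamma D u du -> D t ->
  is_derive (fun s => energy (u s, du s)) t (- gamma * du t ^ 2).
Proof.
  intros H Ht. destruct (H t Ht) as [H1 H2]. unfold energy. simpl fst. simpl snd.
  derive_from_hyps. field.
Qed.

Lemma energy_nonincreasing (gamma : R) (T : Rbar) (u du : R -> R) (s t : R) :
  0 <= gamma -> duffing_on gamma (forward_interval T) u du ->
  0 <= s <= t -> forward_interval T t ->
  energy (u t, du t) <= energy (u s, du s).
Proof.
  intros Hg Hsol Hs Ht.
  apply (derive_nonpos_ge (fun s => energy (u s, du s))
           (fun s => - gamma * du s ^ 2)); [lra| |].
  - intros x Hx. eapply is_derive_energy; [exact Hsol|].
    apply forward_interval_le with t; trivial. lra.
  - intros x Hx. pose proof (pow2_ge_0 (du x)). nra.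
Qed.

(* [1/4 - x^2/2 + x^4/4 = (x^2 - 1)^2/4]: on a sublevel set of the energy below
   1/4, the position stays away from the equilibria 1 and -1. *)
Lemma energy_gap (x y : R) : 1 - 4 * energy (x, y) <= (x ^ 2 - 1) ^ 2.
Proof. unfold energy. simpl fst. simpl snd. pose proof (pow2_ge_0 y). lra. Qed.

(* The sign of [e] selects the region: [e = 1] for K-, [e = -1] for K+. *)
Lemma invariant_side (gamma : R) (T : Rbar) (u du : R -> R) (e t : R) :
  0 <= gamma -> duffing_on gamma (forward_interval T) u du ->
  K (u 0, du 0) -> forward_interval T t ->
  0 < e * (u 0 ^ 2 - 1) -> 0 < e * (u t ^ 2 - 1).
Proof.
  intros Hg Hsol HK Ht H0.
  set (f := fun s => e * (1 - u s ^ 2)).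
  destruct (Rlt_or_le 0 (e * (u t ^ 2 - 1))) as [|Hle]; trivial. exfalso.
  (* At [u^2 = 1] the energy is at least 1/4, which it cannot reach since it starts below and does
     not increase. A change of side would force such a crossing. *)
  assert (Hne : forall s, 0 <= s <= t -> u s ^ 2 <> 1).
  { intros s Hs Heq. pose proof (energy_gap (u s) (du s)) as Hgap.
    assert (energy (u s, du s) <= energy (u 0, du 0)).
    { apply energy_nonincreasing with gamma T; trivial; [lra|].
      now apply forward_interval_le with t. }
    unfold K in HK. rewrite Heq in Hgap. lra. }
  assert (Ht0 : 0 <= t) by apply Ht.
  assert (He : e <> 0) by (intros ->; lra).
  assert (Hft : f t <> 0).
  { unfold f. intros Hft. apply Rmult_integral in Hft.
    apply (Hne t); lra. }
  destruct (IVT_interv f 0 t) as (z & Hz & Hfz).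
  - intros s Hs. destruct (Hsol s) as [H1 _];
      [now apply forward_interval_le with t|].
    apply is_derive_continuity_pt with (e * (- 2 * u s * du s)).
    unfold f. derive_from_hyps. ring.
  - destruct Ht0 as [|<-]; lra.
  - unfold f. lra.
  - unfold f in *. lra.
  - unfold f in Hfz. apply Rmult_integral in Hfz. apply (Hne z); lra.
Qed.

(** The nonlinearity is odd. This reduces [u < -1] to [u > 1], and upper bounds on [- u] yield lower
    bounds on [u]. *)
Lemma duffing_opp (gamma : R) (D : R -> Prop) (u du : R -> R) :
  duffing_on gamma D u du ->
  duffing_on gamma D (fun t => - u t) (fun t => - du t).
Proof.
  intros H t Ht. destruct (H t Ht) as [H1 H2].
  split; derive_from_hyps; ring.
Qed.

(** The energy does not increase, so its initial distance to 1/4 gives a gap uniform in time: a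
    lower bound for the force in K-, coercivity in K+. *)
Lemma energy_gap_sqrt (gamma : R) (T : Rbar) (u du : R -> R) :
  0 <= gamma -> duffing_on gamma (forward_interval T) u du ->
  K (u 0, du 0) ->
  exists d, 0 < d /\ forall t, forward_interval T t -> d <= Rabs (u t ^ 2 - 1).
Proof.
  intros Hg Hsol HK. unfold K in HK.
  exists (sqrt (1 - 4 * energy (u 0, du 0))). split; [apply sqrt_lt_R0; lra|].
  intros t Ht. rewrite <- sqrt_Rsqr_abs. apply sqrt_le_1_alt.
  pose proof (energy_gap (u t) (du t)).
  assert (energy (u t, du t) <= energy (u 0, du 0)).
  { apply energy_nonincreasing with gamma T; trivial. destruct Ht; lra. }
  unfold Rsqr. lra.
Qed.

(** From [energy (x, y) < 1/4], [y^2 < 1/2 - x^2 + x^4/2], which is below [(1 + N^2)^2]. *)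
Lemma velocity_bound (x y N : R) :
  K (x, y) -> Rabs x <= N -> Rabs y <= 1 + N ^ 2.
Proof.
  unfold K, energy. simpl fst. simpl snd. intros HK Hx.
  assert (H0 : 0 <= Rabs x) by apply Rabs_pos.
  assert (Hx2 : x ^ 2 <= N ^ 2).
  { rewrite <- (pow2_abs x). apply pow_incr. lra. }
  assert (Hx4 : x ^ 4 <= N ^ 4).
  { replace (x ^ 4) with ((x ^ 2) ^ 2) by ring.
    replace (N ^ 4) with ((N ^ 2) ^ 2) by ring.
    apply pow_incr. split; trivial. apply pow2_ge_0. }
  pose proof (pow2_ge_0 x). pose proof (pow2_ge_0 (N ^ 2)).
  rewrite <- (Rabs_pos_eq (1 + N ^ 2)) by lra.
  apply Rsqr_le_abs_0. unfold Rsqr. lra.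
Qed.

Lemma K_forward (gamma : R) (T : Rbar) (u du : R -> R) (t : R) :
  0 <= gamma -> duffing_on gamma (forward_interval T) u du ->
  K (u 0, du 0) -> forward_interval T t -> K (u t, du t).
Proof.
  intros Hg Hsol HK Ht. unfold K in *.
  apply Rle_lt_trans with (energy (u 0, du 0)); trivial.
  apply energy_nonincreasing with gamma T; trivial. destruct Ht; lra.
Qed.

(** * Blow-up *)

(** [u^2 > 1] persists by [invariant_side]; to change sign [u] would have to pass through 0, where
    this fails. *)
Lemma outer_stays_right (gamma : R) (T : Rbar) (u du : R -> R) (t : R) :
  0 <= gamma -> duffing_on gamma (forward_interval T) u du ->
  K (u 0, du 0) -> 1 < u 0 -> forward_interval T t -> 1 < u t.
Proof.
  intros Hg Hsol HK H0 Ht.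
  assert (Hout : forall s, forward_interval T s -> 1 < u s ^ 2).
  { intros s Hs. enough (0 < 1 * (u s ^ 2 - 1)) by lra.
    apply invariant_side with gamma T du; trivial. nra. }
  destruct (Rlt_or_le 0 (u t)) as [Hpos | Hneg].
  { specialize (Hout t Ht). nra. }
  exfalso. specialize (Hout t Ht) as Htt.
  assert (Ht0 : 0 <= t) by apply Ht.
  destruct (IVT_interv (fun s => - u s) 0 t) as (z & Hz & Hfz).
  - intros s Hs. destruct (Hsol s) as [H1 _];
      [now apply forward_interval_le with t|].
    apply is_derive_continuity_pt with (- du s). derive_from_hyps. ring.
  - destruct Ht0 as [|<-]; lra.
  - lra.
  - destruct Hneg as [|Heq]; [lra|]. rewrite Heq in Htt. lra.
  - assert (Hfz' : u z = 0) by lra.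
    specialize (Hout z (forward_interval_le T z t Hz Ht)).
    rewrite Hfz' in Hout. lra.
Qed.

(* The restoring force pushes u to infinity, and once u is large and
   increasing, the region u' >= c u^2 is forward invariant, so that 1/u reaches
   0 in finite time. *)
Lemma no_global_outer_right (gamma : R) (u du : R -> R) :
  0 <= gamma -> duffing_on gamma (forward_interval p_infty) u du ->
  K (u 0, du 0) -> ~ 1 < u 0.
Proof.
  intros Hg Hsol HK H0.
  assert (Hin : forall t, 0 <= t -> forward_interval p_infty t) by now split.
  assert (Hu : forall t, 0 <= t -> 1 < u t).
  { intros t Ht. apply outer_stays_right with gamma p_infty du; auto. }
  destruct (energy_gap_sqrt _ _ _ _ Hg Hsol HK) as (d & Hd & Hgap).
  assert (Hforce : forall t, 0 <= t -> d <= u t ^ 3 - u t).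
  { intros t Ht. specialize (Hgap t (Hin t Ht)). specialize (Hu t Ht).
    rewrite Rabs_pos_eq in Hgap by nra. nra. }
  (* Exceeding [u 0] forces a positive velocity on the way to [A]; exceeding [gamma + 2] lets the
     cubic force beat the damping in the proof of [Hric]. *)
  set (A := Rmax (u 0) (gamma + 2) + 1).
  assert (HA1 : u 0 < A) by (unfold A; pose proof (Rmax_l (u 0) (gamma + 2)); lra).
  assert (HA2 : gamma + 2 < A) by (unfold A; pose proof (Rmax_r (u 0) (gamma + 2)); lra).
  assert (Hlin : forall t, 0 <= t ->
            du 0 + gamma * u 0 + d * (t - 0) <= du t + gamma * u t).
  { intros t Ht.
    apply (derive_ge_linear (fun s => du s + gamma * u s)
             (fun s => u s ^ 3 - u s)); trivial.
    - intros s Hs. destruct (Hsol s) as [H1 H2]; [apply Hin; lra|].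
      derive_from_hyps. ring.
    - intros s Hs. apply Hforce. lra. }
  assert (Hreach : exists s, 0 <= s /\ A <= u s).
  { apply NNPP. intros Hno.
    assert (Hsmall : forall s, 0 <= s -> u s < A).
    { intros s Hs. destruct (Rlt_or_le (u s) A); trivial.
      exfalso. apply Hno. now exists s. }
    (* From time [a] on, [Hlin] and [u < A] give [du >= 1]; after a further time [A], [u] would
       exceed [A]. *)
    set (a := Rmax 0 ((1 + gamma * A - du 0 - gamma * u 0) / d)).
    assert (Ha0 : 0 <= a) by apply Rmax_l.
    assert (Ha : 1 + gamma * A - du 0 - gamma * u 0 <= d * a).
    { apply Rmult_le_reg_r with (/ d); [now apply Rinv_0_lt_compat|].
      replace (d * a * / d) with a by (field; lra). apply Rmax_r. }
    assert (u a + 1 * (a + A - a) <= u (a + A)).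
    { apply derive_ge_linear with du; [lra| |].
      - intros t Ht. apply Hsol, Hin. lra.
      - intros t Ht. specialize (Hlin t ltac:(lra)).
        specialize (Hsmall t ltac:(lra)). nra. }
    specialize (Hsmall (a + A) ltac:(lra)). specialize (Hu a Ha0). lra. }
  destruct Hreach as (s & Hs & HAs).
  assert (Hs' : 0 < s) by (destruct Hs as [|<-]; lra).
  destruct (MVT_cor2 u du 0 s Hs') as (x & Hx & Hxs).
  { intros t Ht. apply is_derive_Reals, Hsol, Hin. lra. }
  assert (Hdux : 0 < du x) by nra.
  (* [du * exp (gamma * t)] is nondecreasing because the force is positive, so a positive velocity
     stays positive. *)
  assert (Hdu : forall t, x <= t -> 0 < du t).
  { intros t Ht.
    assert (du x * exp (gamma * x) <= du t * exp (gamma * t)).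
    { apply (derive_nonneg_le (fun r => du r * exp (gamma * r))
               (fun r => (u r ^ 3 - u r) * exp (gamma * r))); trivial.
      - intros r Hr. destruct (Hsol r) as [H1 H2]; [apply Hin; lra|].
        derive_from_hyps. ring.
      - intros r Hr. specialize (Hforce r ltac:(lra)).
        pose proof (exp_pos (gamma * r)). nra. }
    pose proof (exp_pos (gamma * x)). pose proof (exp_pos (gamma * t)). nra. }
  assert (HuA : forall t, s <= t -> A <= u t).
  { intros t Ht. apply Rle_trans with (u s); trivial.
    apply derive_nonneg_le with du; trivial.
    - intros r Hr. apply Hsol, Hin. lra.
    - intros r Hr. apply Rlt_le, Hdu. lra. }
  specialize (Hdu s ltac:(lra)) as Hdus. specialize (Hu s Hs) as Hus.
  (* The second entry makes [du >= c * u^2] true at time [s]; the first makes this region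
     invariant. *)
  set (c := Rmin (1 / 2) (du s / u s ^ 2)).
  assert (Hc : 0 < c).
  { apply Rmin_glb_lt; [lra|]. apply Rdiv_lt_0_compat; [trivial|nra]. }
  assert (Hc2 : c <= 1 / 2) by apply Rmin_l.
  assert (Hcs : c * u s ^ 2 <= du s).
  { assert (Hcr : c <= du s / u s ^ 2) by apply Rmin_r.
    apply Rmult_le_compat_r with (r := u s ^ 2) in Hcr; [|nra].
    replace (du s / u s ^ 2 * u s ^ 2) with (du s) in Hcr by (field; lra).
    trivial. }
  assert (Hric : forall t, s <= t -> c * u t ^ 2 <= du t).
  { intros t Ht. enough (0 <= du t - c * u t ^ 2) by lra.
    apply (barrier_nonneg (fun r => du r - c * u r ^ 2)
             (fun r => u r ^ 3 - u r - gamma * du r - 2 * c * u r * du r) s t);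
      trivial; [| |lra].
    - intros r Hr. destruct (Hsol r) as [H1 H2]; [apply Hin; lra|].
      derive_from_hyps. ring.
    (* Where [du < c * u^2], both [du] and [c] are small enough that the derivative is at least
       [u * (u^2 - 2 - gamma * u) / 2], nonnegative for [u >= A]. *)
    - intros r Hr Hneg. specialize (HuA r ltac:(lra)).
      specialize (Hdu r ltac:(lra)).
      generalize dependent (du r). generalize dependent (u r).
      intros y Hy z Hneg Hz.
      assert (z <= y ^ 2 / 2) by nra.
      assert (gamma * z <= gamma * (y ^ 2 / 2)) by nra.
      assert (c * z <= y ^ 2 / 4) by nra.
      assert (2 * c * y * z <= y ^ 3 / 2) by nra.
      assert (0 <= y * (y ^ 2 - 2 - gamma * y)) by (apply Rmult_le_pos; nra).
      lra. }
  (* [- 1/u] has derivative at least [c], so it gains 1 in time [1/c]; starting above -1 it would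
     become positive, although [u > 0]. *)
  assert (Hend : - / u s + c * (s + / c - s) <= - / u (s + / c)).
  { assert (0 < / c) by now apply Rinv_0_lt_compat.
    apply (derive_ge_linear (fun r => - / u r) (fun r => du r / u r ^ 2));
      [lra| |].
    - intros r Hr. specialize (Hu r ltac:(lra)).
      destruct (Hsol r) as [H1 H2]; [apply Hin; lra|].
      auto_derive; [split; [now exists (du r)|split; [lra|trivial]]|].
      replace (Derive (fun x => u x) r) with (du r)
        by (symmetry; exact (is_derive_unique _ _ _ H1)).
      field. lra.
    - intros r Hr. specialize (Hu r ltac:(lra)). specialize (Hric r ltac:(lra)).
      apply Rmult_le_reg_r with (u r ^ 2); [nra|].
      replace (du r / u r ^ 2 * u r ^ 2) with (du r) by (field; lra). trivial. }
  replace (c * (s + / c - s)) with 1 in Hend by (field; lra).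
  assert (/ u s < 1) by (rewrite <- Rinv_1; apply Rinv_lt_contravar; lra).
  assert (0 < / u (s + / c)).
  { apply Rinv_0_lt_compat.
    assert (0 < / c) by now apply Rinv_0_lt_compat.
    specialize (Hu (s + / c) ltac:(lra)). lra. }
  lra.
Qed.

Lemma no_global_outer (gamma : R) (u du : R -> R) :
  0 <= gamma -> duffing_on gamma (forward_interval p_infty) u du ->
  K (u 0, du 0) -> ~ 1 < Rabs (u 0).
Proof.
  intros Hg Hsol HK H0. unfold Rabs in H0.
  destruct (Rcase_abs (u 0)).
  - apply (no_global_outer_right gamma (fun t => - u t) (fun t => - du t));
      trivial; [now apply duffing_opp|].
    unfold K, energy in *. simpl fst in *. simpl snd in *. lra.
  - now apply (no_global_outer_right gamma u du).
Qed.

(* [u' <= 1/2 + u'^2/2] and [u'^2 = - E'/gamma]. *)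
Lemma position_le_energy_drop (gamma : R) (T : Rbar) (u du : R -> R) (t : R) :
  0 < gamma -> duffing_on gamma (forward_interval T) u du ->
  forward_interval T t ->
  u t <= u 0 + (energy (u 0, du 0) - energy (u t, du t)) / (2 * gamma) + t / 2.
Proof.
  intros Hg Hsol Ht.
  assert (H : u t + energy (u t, du t) / (2 * gamma) - t / 2
            <= u 0 + energy (u 0, du 0) / (2 * gamma) - 0 / 2).
  { apply (derive_nonpos_ge
      (fun s => u s + energy (u s, du s) / (2 * gamma) - s / 2)
      (fun s => du s - du s ^ 2 / 2 - 1 / 2)); [apply Ht| |].
    - intros s Hs.
      assert (Hs' : forward_interval T s) by now apply forward_interval_le with t.
      destruct (Hsol s Hs') as [H1 _].
      pose proof (is_derive_energy _ _ _ _ _ Hsol Hs') as H2.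
      set (E := fun s => energy (u s, du s)) in *.
      change (is_derive (fun s => u s + E s / (2 * gamma) - s / 2) s
                (du s - du s ^ 2 / 2 - 1 / 2)).
      derive_from_hyps. field. lra.
    - intros s _. pose proof (pow2_ge_0 (du s - 1)). lra. }
  unfold Rdiv in *. lra.
Qed.

(** The bound of [position_le_energy_drop] applied to [u] and to [- u], which have the same energy,
    controls the position because [T] is finite. The energy then controls the velocity. *)
Lemma energy_bounded_below_bounded (gamma T B : R) (u du : R -> R) :
  0 < gamma -> duffing_on gamma (forward_interval T) u du ->
  K (u 0, du 0) ->
  (forall t, forward_interval T t -> B <= energy (u t, du t)) ->
  exists M, forall t, forward_interval T t -> Rabs (u t) <= M /\ Rabs (du t) <= M.
Proof.
  intros Hg Hsol HK HB.
  set (N := Rabs (u 0) + (1 / 4 - B) / (2 * gamma) + T / 2).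
  assert (HN : forall t, forward_interval T t -> Rabs (u t) <= N).
  { intros t Ht. pose proof (position_le_energy_drop _ _ _ _ _ Hg Hsol Ht) as H1.
    pose proof (position_le_energy_drop _ _ _ _ _ Hg (duffing_opp _ _ _ _ Hsol) Ht) as H2.
    simpl in H2.
    assert (Heven : forall x y, energy (- x, - y) = energy (x, y))
      by (intros x y; unfold energy; simpl; field).
    rewrite !Heven in H2.
    assert (He : (energy (u 0, du 0) - energy (u t, du t)) / (2 * gamma)
                 <= (1 / 4 - B) / (2 * gamma)).
    { apply Rmult_le_compat_r; [apply Rlt_le, Rinv_0_lt_compat; lra|].
      specialize (HB t Ht). unfold K in HK. lra. }
    pose proof (Rle_abs (u 0)). pose proof (Rle_abs (- u 0)) as H3.
    rewrite Rabs_Ropp in H3.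
    destruct Ht as [Ht0 HtT]. simpl in HtT.
    apply Rabs_le. unfold N. lra. }
  exists (1 + N + N ^ 2). intros t Ht. specialize (HN t Ht).
  assert (Rabs (du t) <= 1 + N ^ 2).
  { apply velocity_bound with (u t); trivial.
    apply K_forward with gamma T; trivial. lra. }
  pose proof (Rabs_pos (u t)). pose proof (pow2_ge_0 N). lra.
Qed.

(** * Decay *)

Lemma inner_decay (gamma : R) (u du : R -> R) :
  0 < gamma -> duffing_on gamma (forward_interval p_infty) u du ->
  K (u 0, du 0) -> Rabs (u 0) < 1 ->
  exists C k, 0 < C /\ 0 < k /\
    forall t, 0 <= t -> u t ^ 2 + du t ^ 2 <= C * exp (- k * t).
Proof.
  intros Hg Hsol HK H0.
  assert (Hin : forall t, 0 <= t -> forward_interval p_infty t) by now split.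
  assert (Hg0 : 0 <= gamma) by lra.
  assert (Hu : forall t, 0 <= t -> u t ^ 2 < 1).
  { intros t Ht. enough (0 < -1 * (u t ^ 2 - 1)) by lra.
    apply invariant_side with gamma p_infty du; auto.
    apply Rabs_def2 in H0. nra. }
  destruct (energy_gap_sqrt _ _ _ _ Hg0 Hsol HK) as (d & Hd & Hgap).
  assert (Hud : forall t, 0 <= t -> d <= 1 - u t ^ 2).
  { intros t Ht. specialize (Hgap t (Hin t Ht)). specialize (Hu t Ht).
    rewrite Rabs_left in Hgap by lra. lra. }
  (* The value for which [d/2 * x^2 + gamma * x * y + eta * y^2] is a perfect square up to a
     factor. *)
  set (eta := gamma ^ 2 / (2 * d)).
  assert (Heta : 0 < eta) by (apply Rdiv_lt_0_compat; nra).
  (* The bound 1/4 keeps [V] comparable to [u^2 + du^2]; the other one makes the terms in [du^2]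
     produced by the correction cost at most half of the damping. *)
  set (eps := Rmin (1 / 4) (gamma / 2 / (1 + eta))).
  assert (He : 0 < eps).
  { apply Rmin_glb_lt; [lra|]. apply Rdiv_lt_0_compat; lra. }
  assert (He1 : eps <= 1 / 4) by apply Rmin_l.
  assert (He2 : eps * (1 + eta) <= gamma / 2).
  { apply Rle_trans with (gamma / 2 / (1 + eta) * (1 + eta)).
    - apply Rmult_le_compat_r; [lra|]. apply Rmin_r.
    - apply Req_le. field. lra. }
  (* These are the coefficients of [du^2] and [u^2] left in [- V'] once the cross term is
     absorbed. *)
  set (k := Rmin (gamma / 2) (eps * d / 2)).
  assert (Hk : 0 < k) by (apply Rmin_glb_lt; nra).
  assert (Hk1 : k <= gamma / 2) by apply Rmin_l.
  assert (Hk2 : k <= eps * d / 2) by apply Rmin_r.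
  set (V := fun t => energy (u t, du t) + eps * (u t * du t)).
  assert (HV : forall t, 0 <= t ->
            (u t ^ 2 + du t ^ 2) / 8 <= V t <= u t ^ 2 + du t ^ 2).
  { intros t Ht. specialize (Hu t Ht). unfold V, energy. simpl fst. simpl snd.
    generalize dependent (u t). generalize (du t). intros y x Hx.
    pose proof (pow2_ge_0 x). pose proof (pow2_ge_0 y).
    assert (Hxy : - (x ^ 2 + y ^ 2) / 2 <= x * y <= (x ^ 2 + y ^ 2) / 2).
    { pose proof (pow2_ge_0 (x - y)). pose proof (pow2_ge_0 (x + y)). lra. }
    assert (0 <= x ^ 4 <= x ^ 2) by (replace (x ^ 4) with (x ^ 2 * x ^ 2) by ring; nra).
    assert (- (x ^ 2 + y ^ 2) / 8 <= eps * (x * y) <= (x ^ 2 + y ^ 2) / 8)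
      by (split; nra).
    lra. }
  assert (Hdecay : forall t, 0 <= t -> V t <= V 0 * exp (- k * (t - 0))).
  { intros t Ht.
    apply gronwall_le with (f' := fun s =>
      - gamma * du s ^ 2
      + eps * (du s ^ 2 + u s * (u s ^ 3 - u s - gamma * du s))); trivial.
    - intros s Hs. assert (Hs' : forward_interval p_infty s) by (apply Hin; lra).
      destruct (Hsol s Hs') as [H1 H2].
      pose proof (is_derive_energy _ _ _ _ _ Hsol Hs') as H3.
      set (E := fun s => energy (u s, du s)) in *.
      change (is_derive (fun s => E s + eps * (u s * du s)) s
        (- gamma * du s ^ 2
         + eps * (du s ^ 2 + u s * (u s ^ 3 - u s - gamma * du s)))).
      derive_from_hyps. ring.
    - intros s Hs. specialize (HV s ltac:(lra)). specialize (Hud s ltac:(lra)).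
      (* The upper comparison [V <= u^2 + du^2] turns the dissipation into [- k * V]. *)
      apply Rle_trans with (- k * (u s ^ 2 + du s ^ 2)); [|nra].
      clear HV. generalize dependent (u s). generalize (du s). intros y x Hx.
      (* the cross term, absorbed by completing the square in [d x + gamma y] *)
      assert (Hsq : 0 <= eps * (d / 2 * x ^ 2 + gamma * (x * y) + eta * y ^ 2)).
      { replace (d / 2 * x ^ 2 + gamma * (x * y) + eta * y ^ 2)
          with ((d * x + gamma * y) ^ 2 * / (2 * d)) by (unfold eta; field; lra).
        apply Rmult_le_pos; [lra|]. apply Rmult_le_pos; [apply pow2_ge_0|].
        apply Rlt_le, Rinv_0_lt_compat. lra. }
      pose proof (pow2_ge_0 x). pose proof (pow2_ge_0 y).
      assert (eps * (x ^ 2 * d) <= eps * (x ^ 2 * (1 - x ^ 2))).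
      { apply Rmult_le_compat_l; [lra|]. now apply Rmult_le_compat_l. }
      assert (eps * (1 + eta) * y ^ 2 <= gamma / 2 * y ^ 2)
        by now apply Rmult_le_compat_r.
      assert (k * y ^ 2 <= gamma / 2 * y ^ 2) by now apply Rmult_le_compat_r.
      assert (k * x ^ 2 <= eps * d / 2 * x ^ 2) by now apply Rmult_le_compat_r.
      lra. }
  (* The 8 comes from the lower comparison in [HV]; the 1 keeps the constant positive for the zero
     solution. *)
  exists (8 * V 0 + 1), k.
  assert (HV0 : 0 <= V 0).
  { destruct (HV 0 (Rle_refl 0)) as [H1 _].
    pose proof (pow2_ge_0 (u 0)). pose proof (pow2_ge_0 (du 0)). lra. }
  split; [lra|]. split; [trivial|].
  intros t Ht. specialize (Hdecay t Ht). destruct (HV t Ht) as [H1 _].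
  rewrite Rminus_0_r in Hdecay. pose proof (exp_pos (- k * t)). lra.
Qed.

(** Taking the square root halves the rate. The bound itself yields the limit, as it tends to 0. *)
Lemma tends_exponentially_of_sq (f g : R -> R) (C k : R) :
  0 < C -> 0 < k ->
  (forall t, 0 <= t -> f t ^ 2 + g t ^ 2 <= C * exp (- k * t)) ->
  tends_exponentially (fun t => (f t, g t)) (0, 0).
Proof.
  intros HC Hk Hfg.
  assert (Hdist : forall t, 0 <= t ->
            dist2 (f t, g t) (0, 0) <= sqrt C * exp (- (k / 2) * t)).
  { intros t Ht. unfold dist2. simpl fst. simpl snd.
    rewrite !Rminus_0_r.
    rewrite <- (sqrt_Rsqr (exp (- (k / 2) * t))) by apply Rlt_le, exp_pos.
    rewrite <- sqrt_mult_alt by lra. apply sqrt_le_1_alt.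
    unfold Rsqr. rewrite <- exp_plus.
    replace (- (k / 2) * t + - (k / 2) * t) with (- k * t) by field. auto. }
  split.
  2: { exists (sqrt C), (k / 2). split; [now apply sqrt_lt_R0|]. split; [lra|trivial]. }
  assert (Hlim : is_lim (fun t => sqrt C * exp (- (k / 2) * t)) p_infty 0).
  { replace (Finite 0) with (Rbar_mult (sqrt C) 0) by (simpl; f_equal; ring).
    apply is_lim_scal_l.
    apply (is_lim_comp exp (fun t => - (k / 2) * t) p_infty 0 m_infty).
    - apply is_lim_exp_m.
    - replace m_infty with (Rbar_mult (- (k / 2)) p_infty).
      + apply is_lim_scal_l. apply is_lim_id.
      + simpl. destruct (Rle_dec 0 (- (k / 2))); [exfalso; lra|reflexivity].
    - now exists 0. }
  apply filterlim_locally. intros eps.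
  apply is_lim_spec in Hlim. destruct (Hlim eps) as [A HA].
  exists (Rmax A 0). intros t Ht.
  assert (HtA : A < t) by (pose proof (Rmax_l A 0); lra).
  assert (Ht0 : 0 <= t) by (pose proof (Rmax_r A 0); lra).
  specialize (HA t HtA). specialize (Hdist t Ht0).
  apply Rabs_def2 in HA.
  assert (Hlt : dist2 (f t, g t) (0, 0) < eps) by lra.
  unfold dist2 in Hlt. simpl fst in Hlt. simpl snd in Hlt.
  (* Neighbourhoods in [R * R] are products of balls, so the Euclidean bound is passed to each
     coordinate. *)
  pose proof (sqrt_plus_sqr (f t - 0) (g t - 0)) as [Hmax _].
  pose proof (Rmax_l (Rabs (f t - 0)) (Rabs (g t - 0))).
  pose proof (Rmax_r (Rabs (f t - 0)) (Rabs (g t - 0))).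
  split; simpl;
    [change (Rabs (f t - 0) < eps) | change (Rabs (g t - 0) < eps)]; lra.
Qed.

Theorem proposition1 (gamma u0 u1 : R) (T : Rbar) (u du : R -> R)
    (hgamma : 0 <= gamma)
    (hK : K (u0, u1))
    (hu : is_maximal_forward_solution gamma (u0, u1) T u du) :
  (Kminus (u0, u1) ->
     Rbar_lt T p_infty /\
     (0 < gamma ->
        filterlim (fun t => energy (u t, du t))
          (at_left (real T)) (Rbar_locally m_infty))) /\
  (Kplus (u0, u1) ->
     T = p_infty /\
     (0 < gamma -> tends_exponentially (fun t => (u t, du t)) (0, 0))).
Proof.
  pose proof (proj1 hu) as Hsol.
  destruct (duffing_of_forward _ _ _ _ _ Hsol) as (v & dv & Hv & Hdv).
  destruct Hsol as (HT & Hp & _). injection Hp as <- <-.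
  destruct (Hv 0 (Rle_refl 0)) as [Hv0 Hdv0].
  assert (HKv : K (v 0, dv 0)) by now rewrite Hv0, Hdv0.
  split.
  - intros [_ Hout]. simpl fst in Hout.
    destruct T as [T| |]; [| |easy].
    2: { exfalso. apply (no_global_outer gamma v dv); trivial.
         rewrite Hv0. lra. }
    split; [exact I|]. intros Hg P [B HB]. simpl real. simpl in HT.
    (* Otherwise the energy would be bounded below by [B] up to the finite time [T], hence the
       solution bounded, against maximality. Once below [B], the energy stays there. *)
    assert (Hlow : exists t, forward_interval T t /\ energy (v t, dv t) < B).
    { apply NNPP. intros Hno.
      destruct (energy_bounded_below_bounded gamma T B v dv) as [M HM]; trivial.
      - intros t Ht. destruct (Rle_or_lt B (energy (v t, dv t))); trivial.
        exfalso. apply Hno. now exists t.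
      - apply (maximal_not_bounded gamma T M (u 0, du 0) u du); trivial.
        intros t Ht. destruct (Hv t (proj1 Ht)) as [<- <-]. auto. }
    destruct Hlow as (s & [Hs HsT] & HsB). simpl in HsT.
    assert (Hnear : locally T (fun t => s < t)) by now apply (open_gt s).
    unfold filtermap, at_left, within.
    eapply filter_imp; [|exact Hnear]. intros t Hst HtT. apply HB.
    destruct (Hv t) as [<- <-]; [lra|].
    apply Rle_lt_trans with (energy (v s, dv s)); trivial.
    apply energy_nonincreasing with gamma T; trivial; [lra|split; simpl; lra].
  - intros [_ Hin]. simpl fst in Hin.
    assert (Hv1 : Rabs (v 0) < 1) by now rewrite Hv0.
    assert (HTinf : T = p_infty).
    { destruct T as [T| |]; [exfalso|easy|easy].
      (* The bound 2 is [1 + N^2] of [velocity_bound] at [N = 1]. *)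
      apply (maximal_not_bounded gamma T 2 (u 0, du 0) u du); trivial.
      intros t Ht. destruct (Hv t (proj1 Ht)) as [<- <-].
      assert (Hvt : Rabs (v t) <= 1).
      { apply Rabs_le.
        assert (0 < -1 * (v t ^ 2 - 1)); [|nra].
        apply invariant_side with gamma T dv; trivial.
        apply Rabs_def2 in Hv1. nra. }
      split; [lra|].
      replace 2 with (1 + 1 ^ 2) by ring.
      apply velocity_bound with (v t); trivial.
      now apply K_forward with gamma T. }
    split; trivial. intros Hg. subst T.
    destruct (inner_decay gamma v dv) as (C & k & HC & Hk & Hdecay); trivial.
    apply tends_exponentially_of_sq with C k; trivial.
    intros t Ht. destruct (Hv t Ht) as [<- <-]. auto.
Qed.
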